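(* Let $(M,g)$ be a general relativistic perfect fluid spacetime of dimension $4$ with isotropic pressure $p$, energy-density $\sigma$, cosmological constant $\lambda$, gravitational constant $k$, whose velocity vector field is a gradient, $\xi:=\mathrm{grad}(f)$ for a smooth function $f$ on $M$, with $g(\xi,\xi)=-1$, and let $\eta$ be the $g$-dual $1$-form of $\xi$. If the equation $$\mathcal{L}_{\xi}g+2S+2a g+2b\,\eta\otimes \eta=0,$$ with $a,b$ real constants, defines an $\eta$-Ricci soliton $(g,\xi,a,b)$ in $M$ (i.e. the equation holds on $M$), then $f$ satisfies the Poisson equation $$\Delta(f)=-3[b+k(\sigma+p)].$$
   Context: A perfect fluid spacetime here is a $4$-dimensional smooth manifold $M$ with a Lorentzian metric $g$ (one negative sign in the signature), a smooth velocity vector field $\xi$ with $g(\xi,\xi)=-1$ and dual $1$-form $\eta(X)=g(X,\xi)$, and smooth functions $p$ (pressure) and $\sigma$ (energy-density), such that Einstein's equations $kT=S+(\lambda-\frac r2)g$ hold with $T=pg+(\sigma+p)\eta\otimes\eta$; equivalently $$S(X,Y)=\left(\lambda+\frac{k(\sigma-p)}{2}\right)g(X,Y)+k(\sigma+p)\eta(X)\eta(Y)$$ for all vector fields $X,Y$. Here $S$ is the Ricci tensor, $r$ the scalar curvature, $\lambda$ a real constant and $k>0$ a real constant (e.g. $k=8\pi G$). $\mathcal{L}_\xi g$ is the Lie derivative of $g$ along $\xi$, and $\Delta(f)=\mathrm{div}(\mathrm{grad}(f))$, where $\mathrm{div}(X)$ is the trace of $Y\mapsto\nabla_YX$ for the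 Levi-Civita connection $\nabla$. *)

(* Defs.v *)
From HB Require Import structures.
From mathcomp Require Import all_boot all_order all_algebra.
From mathcomp Require Import all_classical all_reals all_analysis.
From mathcomp Require Import ring.

Set Implicit Arguments.
Unset Strict Implicit.
Unset Printing Implicit Defensive.

Import Order.TTheory GRing.Theory Num.Theory.
Import numFieldNormedType.Exports.

Local Open Scope classical_set_scope.
Local Open Scope ring_scope.

(* [U] is meant to be open. *)
Fixpoint Cn_on (R : realType) (V W : normedModType R) (k : nat) (U : set V)
    (f : V -> W) : Prop :=
  if k is k'.+1 then
    (forall u, U u -> differentiable f u) /\
    (forall v, Cn_on k' U (fun u => 'D_v f u))
  else forall u, U u -> {for u, continuous f}.

Definition smooth_on (R : realType) (V W : normedModType R) (U : set V)
    (f : V -> W) : Prop := forall k, Cn_on k U f.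

(* [chart_inv i] inverts [chart_map i] on [chart_map i @` chart_dom i]; its values elsewhere are
   irrelevant. The atlas need not be maximal. *)
Record smooth_manifold (R : realType) (n : nat) (M : topologicalType) :=
  SmoothManifold {
    chart : Type;
    chart_dom : chart -> set M;
    chart_map : chart -> M -> 'rV[R]_n;
    chart_inv : chart -> 'rV[R]_n -> M;
    manifold_hausdorff : hausdorff_space M;
    manifold_second_countable : @second_countable M;
    chart_dom_open : forall i, open (chart_dom i);
    chart_dom_cover : forall x, exists i, chart_dom i x;
    chart_img_open : forall i, open (chart_map i @` chart_dom i);
    chart_mapK : forall i x, chart_dom i x -> chart_inv i (chart_map i x) = x;
    chart_map_continuous :
      forall i x, chart_dom i x -> {for x, continuous (chart_map i)};
    chart_inv_continuous :
      forall i u, (chart_map i @` chart_dom i) u -> {for u, continuous (chart_inv i)};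
    transition_smooth : forall i j,
      smooth_on (chart_map i @` (chart_dom i `&` chart_dom j)) (chart_map j \o chart_inv i) }.

Arguments chart {R n M}.

(* Tensor calculus in the coordinates of one chart. Vectors are rows, a vector
   field is a map ['rV_n -> 'rV_n], and a metric is its Gram matrix
   [G : 'rV_n -> 'M_n] in the coordinate frame. *)
Section LocalGeometry.
Variables (R : realType) (n : nat).
Notation E := 'rV[R]_n.

Definition basis_vec (i : 'I_n) : E := delta_mx 0 i.

Definition inner (A : 'M[R]_n) (v w : E) : R := (v *m A *m w^T) 0 0.

Definition partial (i : 'I_n) (h : E -> R) (u : E) : R := 'D_(basis_vec i) h u.

Definition lie_bracket (X Y : E -> E) (u : E) : E :=
  'D_(X u) Y u - 'D_(Y u) X u.

Definition trace (L : E -> E) : R := \tr (lin1_mx L).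

Variable G : E -> 'M[R]_n.

(* the symbol with lower indices i, j and upper index k *)
Definition christoffel (u : E) (i j k : 'I_n) : R :=
  2^-1 * \sum_l (partial i (fun w => G w j l) u + partial j (fun w => G w i l) u
                 - partial l (fun w => G w i j) u) * invmx (G u) l k.

(* The Levi-Civita connection, [nabla X Y] being the derivative of [Y] along
   [X]: see [nabla_torsion_free] and [nabla_metric]. *)
Definition nabla (X Y : E -> E) (u : E) : E :=
  'D_(X u) Y u +
  \row_k \sum_i \sum_j X u 0 i * Y u 0 j * christoffel u i j k.

Definition curvature (X Y Z : E -> E) (u : E) : E :=
  nabla X (nabla Y Z) u - nabla Y (nabla X Z) u - nabla (lie_bracket X Y) Z u.

(* S(X, Y) is the trace of Z |-> R(Z, X) Y. By tensoriality the vector Z may be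
   extended to a constant field. *)
Definition ricci (X Y : E -> E) (u : E) : R :=
  trace (fun z => curvature (cst z) X Y u).

Definition scalar_curvature (u : E) : R :=
  \sum_i \sum_j invmx (G u) i j *
                ricci (cst (basis_vec i)) (cst (basis_vec j)) u.

Definition lie_metric (Z X Y : E -> E) (u : E) : R :=
  'D_(Z u) (fun w => inner (G w) (X w) (Y w)) u
  - inner (G u) (lie_bracket Z X u) (Y u)
  - inner (G u) (X u) (lie_bracket Z Y u).

Definition divergence (X : E -> E) (u : E) : R :=
  trace (fun y => nabla (cst y) X u).

(* See [gradP]. *)
Definition grad (h : E -> R) (u : E) : E :=
  (\row_j partial j h u) *m invmx (G u).

Definition laplacian (h : E -> R) : E -> R := divergence (grad h).

Definition dual_form (Z X : E -> E) (u : E) : R := inner (G u) (X u) (Z u).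

End LocalGeometry.

Section LeviCivita.
Variables (R : realType) (n : nat).
Notation E := 'rV[R]_n.

Lemma innerE (A : 'M[R]_n) (v w : E) :
  inner A v w = \sum_i \sum_j v 0 i * A i j * w 0 j.
Proof.
rewrite /inner mxE exchange_big; apply: eq_bigr => j _.
by rewrite !mxE big_distrl.
Qed.

Lemma differentiable_entry m p (F : E -> 'M[R]_(m, p)) u i j :
  differentiable F u -> differentiable (fun w => F w i j) u.
Proof.
move=> dF.
exact: (differentiable_comp dF (differentiable_coord (F u) i j)).
Qed.

Lemma derive_entry m p (F : E -> 'M[R]_(m, p)) u v i j :
  differentiable F u -> 'D_v F u i j = 'D_v (fun w => F w i j) u.
Proof. by move=> dF; rewrite derive_mx ?mxE//; exact: diff_derivable. Qed.

Lemma derive_partial (h : E -> R) u v : differentiable h u ->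
  'D_v h u = \sum_i v 0 i * partial i h u.
Proof.
move=> dh; rewrite deriveE// [in LHS](row_sum_delta v) linear_sum.
by apply: eq_bigr => i _; rewrite linearZ /partial deriveE.
Qed.

Lemma derive_inner (F : E -> 'M[R]_n) (Y Z : E -> E) u v :
  differentiable F u -> differentiable Y u -> differentiable Z u ->
  'D_v (fun w => inner (F w) (Y w) (Z w)) u =
  inner ('D_v F u) (Y u) (Z u) + inner (F u) ('D_v Y u) (Z u)
  + inner (F u) (Y u) ('D_v Z u).
Proof.
move=> dF dY dZ.
pose y i (w : E) : R := Y w 0 i; pose z i (w : E) : R := Z w 0 i.
pose f i j (w : E) : R := F w i j.
have dy i : derivable (y i) u v.
  exact/diff_derivable/differentiable_entry.
have dz i : derivable (z i) u v.
  exact/diff_derivable/differentiable_entry.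
have df i j : derivable (f i j) u v.
  exact/diff_derivable/differentiable_entry.
have -> : (fun w => inner (F w) (Y w) (Z w)) =
          \sum_i \sum_j ((y i * f i j) * z j).
  apply/funext => w; rewrite innerE fct_sumE; apply: eq_bigr => i _.
  by rewrite fct_sumE.
have dyf i j : derivable (y i * f i j) u v by exact: derivableM.
have dyfz i j : derivable (y i * f i j * z j) u v by exact: derivableM.
rewrite derive_sum => [|i]; last exact: derivable_sum.
rewrite !innerE -!big_split /=; apply: eq_bigr => i _.
rewrite derive_sum//.
rewrite -!big_split /=; apply: eq_bigr => j _.
rewrite deriveM// deriveM// !derive_entry// /GRing.scale/=.
rewrite -/(y i) -/(z j) -/(f i j) -/(y i u) -/(z j u) -/(f i j u).
have -> : (y i * f i j) u = y i u * f i j u by [].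
ring.
Qed.

Variables (G : E -> 'M[R]_n) (u : E).
Hypothesis G_sym : \forall w \near u, (G w)^T = G w.

Let partial_sym i j k :
  partial k (fun w => G w i j) u = partial k (fun w => G w j i) u.
Proof.
apply: near_eq_derive; apply: filterS G_sym => w Gw.
by rewrite -[in LHS]Gw mxE.
Qed.

Lemma christoffel_sym i j k : christoffel G u i j k = christoffel G u j i k.
Proof.
rewrite /christoffel; congr (_ * _); apply: eq_bigr => l _.
by rewrite [partial l _ _]partial_sym [X in X - _]addrC.
Qed.

Lemma nabla_torsion_free (X Y : E -> E) :
  nabla G X Y u - nabla G Y X u = lie_bracket X Y u.
Proof.
rewrite /nabla /lie_bracket opprD addrACA -[RHS]addr0; congr (_ + _).
apply/rowP => k; rewrite !mxE exchange_big; apply/eqP; rewrite subr_eq0.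
apply/eqP; apply: eq_bigr => i _; apply: eq_bigr => j _.
by rewrite christoffel_sym [X u 0 j * _]mulrC.
Qed.

Hypothesis G_unit : G u \in unitmx.

Lemma gradP (h : E -> R) v : differentiable h u ->
  inner (G u) (grad G h u) v = 'D_v h u.
Proof.
move=> dh; rewrite /inner /grad mulmxKV// derive_partial// mxE.
by apply: eq_bigr => i _; rewrite !mxE mulrC.
Qed.

Lemma christoffel_lower i j k :
  \sum_l christoffel G u i j l * G u l k =
  2^-1 * (partial i (fun w => G w j k) u + partial j (fun w => G w i k) u
          - partial k (fun w => G w i j) u).
Proof.
pose c : E := \row_l (partial i (fun w => G w j l) u +
  partial j (fun w => G w i l) u - partial l (fun w => G w i j) u).
have -> : \sum_l christoffel G u i j l * G u l k =
    2^-1 * (c *m invmx (G u) *m G u) 0 k.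
  rewrite mxE big_distrr; apply: eq_bigr => l _.
  rewrite /christoffel -mulrA mxE.
  by congr (_ * (_ * _)); apply: eq_bigr => m _; rewrite mxE.
by rewrite mulmxKV// mxE.
Qed.

Let sum3_rot (F : 'I_n -> 'I_n -> 'I_n -> R) :
  \sum_i \sum_a \sum_b F i a b = \sum_b \sum_i \sum_a F i a b.
Proof.
by rewrite [RHS]exchange_big; apply: eq_bigr => i _; rewrite exchange_big.
Qed.

Lemma nabla_metric (X Y Z : E -> E) :
  differentiable G u -> differentiable Y u -> differentiable Z u ->
  'D_(X u) (fun w => inner (G w) (Y w) (Z w)) u =
  inner (G u) (nabla G X Y u) (Z u) + inner (G u) (Y u) (nabla G X Z u).
Proof.
move=> dG dY dZ; rewrite derive_inner// /nabla.
set DG := 'D_(X u) G u; set DY := 'D_(X u) Y u; set DZ := 'D_(X u) Z u.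
set GY := \row_k _; set GZ := \row_k _.
have -> : inner (G u) (DY + GY) (Z u) =
    inner (G u) DY (Z u) + inner (G u) GY (Z u).
  by rewrite /inner !mulmxDl mxE.
have -> : inner (G u) (Y u) (DZ + GZ) =
    inner (G u) (Y u) DZ + inner (G u) (Y u) GZ.
  by rewrite /inner linearD /= mulmxDr mxE.
suff -> : inner DG (Y u) (Z u) =
    inner (G u) GY (Z u) + inner (G u) (Y u) GZ by ring.
have GuE i j : G u i j = G u j i by rewrite -[in LHS](nbhs_singleton G_sym) mxE.
have -> : inner DG (Y u) (Z u) = \sum_i \sum_a \sum_b
    X u 0 i * Y u 0 a * Z u 0 b * partial i (fun w => G w a b) u.
  rewrite innerE [RHS]exchange_big; apply: eq_bigr => a _ /=.
  rewrite [RHS]exchange_big; apply: eq_bigr => b _ /=.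
  rewrite /DG derive_entry// derive_partial; last exact: differentiable_entry.
  rewrite big_distrr big_distrl; apply: eq_bigr => i _ /=.
  ring.
have -> : inner (G u) GY (Z u) = \sum_i \sum_a \sum_b
    X u 0 i * Y u 0 a * Z u 0 b * \sum_l christoffel G u i a l * G u l b.
  rewrite innerE exchange_big [RHS]sum3_rot; apply: eq_bigr => b _ /=.
  under [RHS]eq_bigr => i _ do under eq_bigr => a _ do rewrite big_distrr.
  rewrite [RHS]sum3_rot; apply: eq_bigr => l _ /=.
  rewrite mxE !big_distrl; apply: eq_bigr => i _ /=.
  rewrite !big_distrl; apply: eq_bigr => a _ /=.
  ring.
have -> : inner (G u) (Y u) GZ = \sum_i \sum_a \sum_b
    X u 0 i * Y u 0 a * Z u 0 b * \sum_l christoffel G u i b l * G u l a.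
  rewrite innerE; under [RHS]eq_bigr => i _ do rewrite exchange_big.
  rewrite [RHS]sum3_rot; apply: eq_bigr => a _ /=.
  under [RHS]eq_bigr => i _ do under eq_bigr => b _ do rewrite big_distrr.
  rewrite [RHS]sum3_rot; apply: eq_bigr => l _ /=.
  rewrite !mxE big_distrr; apply: eq_bigr => i _ /=.
  rewrite big_distrr; apply: eq_bigr => b _ /=.
  rewrite (GuE a l); ring.
rewrite -big_split; apply: eq_bigr => i _.
rewrite -big_split; apply: eq_bigr => a _.
rewrite -big_split; apply: eq_bigr => b _ /=.
rewrite !christoffel_lower (partial_sym b a) [partial a _ _]partial_sym.
by rewrite [partial b _ _]partial_sym; field.
Qed.

End LeviCivita.

(* Geometric objects on a manifold are families of local representatives,
   indexed by the charts, that obey the tensor transformation law. *)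
Section Manifold.
Variables (R : realType) (n : nat) (M : topologicalType).
Variable A : smooth_manifold R n M.
Notation E := 'rV[R]_n.

Definition chart_img (i : chart A) : set E := chart_map i @` chart_dom i.

Definition transition (i j : chart A) : E -> E := chart_map j \o chart_inv i.

Definition smooth_function (h : M -> R) : Prop :=
  forall i : chart A, smooth_on (chart_img i) (h \o chart_inv i).

Definition vector_field (X : chart A -> E -> E) : Prop :=
  (forall i, smooth_on (chart_img i) (X i)) /\
  forall (i j : chart A) x, chart_dom i x -> chart_dom j x ->
    X j (chart_map j x) = 'D_(X i (chart_map i x)) (transition i j) (chart_map i x).

(* diag(-1, 1, ..., 1) *)
Definition minkowski : 'M[R]_n :=
  diag_mx (\row_(i < n) (if i == 0%N :> nat then -1 else 1)).

Definition lorentzian_metric (g : chart A -> E -> 'M[R]_n) : Prop :=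
  [/\ forall i, smooth_on (chart_img i) (g i),
      forall i u, chart_img i u -> (g i u)^T = g i u,
      forall i u, chart_img i u ->
        exists2 P, P \in unitmx & P *m g i u *m P^T = minkowski &
      forall (i j : chart A) x v w, chart_dom i x -> chart_dom j x ->
        inner (g i (chart_map i x)) v w =
        inner (g j (chart_map j x)) ('D_v (transition i j) (chart_map i x))
                                ('D_w (transition i j) (chart_map i x))].

Definition energy_momentum (G : E -> 'M[R]_n) (xi : E -> E) (p sigma : E -> R)
    (X Y : E -> E) (u : E) : R :=
  p u * inner (G u) (X u) (Y u) +
  (sigma u + p u) * (dual_form G xi X u * dual_form G xi Y u).

(* [X] and [Y] range over the vector fields of each chart domain: these are
   identities between tensor fields, hence local. *)
Definition perfect_fluid_spacetime (g : chart A -> E -> 'M[R]_n)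
    (xi : chart A -> E -> E) (p sigma : M -> R) (lambda k : R) : Prop :=
  [/\ lorentzian_metric g, vector_field xi,
      smooth_function p /\ smooth_function sigma,
      forall i u, chart_img i u -> inner (g i u) (xi i u) (xi i u) = -1 &
      forall i X Y, smooth_on (chart_img i) X -> smooth_on (chart_img i) Y ->
      forall u, chart_img i u ->
        k * energy_momentum (g i) (xi i) (p \o chart_inv i) (sigma \o chart_inv i) X Y u
        = ricci (g i) X Y u
          + (lambda - scalar_curvature (g i) u / 2) * inner (g i u) (X u) (Y u)].

Definition eta_ricci_soliton (g : chart A -> E -> 'M[R]_n)
    (xi : chart A -> E -> E) (a b : R) : Prop :=
  forall i X Y, smooth_on (chart_img i) X -> smooth_on (chart_img i) Y ->
  forall u, chart_img i u ->
    lie_metric (g i) (xi i) X Y u + 2 * ricci (g i) X Y u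
    + 2 * a * inner (g i u) (X u) (Y u)
    + 2 * b * (dual_form (g i) (xi i) X u * dual_form (g i) (xi i) Y u) = 0.

End Manifold.

(* Main.v *)
Require Import Defs.
From HB Require Import structures.
From mathcomp Require Import all_boot all_order all_algebra.
From mathcomp Require Import all_classical all_reals all_analysis.
From mathcomp Require Import ring lra.

Set Implicit Arguments.
Unset Strict Implicit.
Unset Printing Implicit Defensive.

Import Order.TTheory GRing.Theory Num.Theory.
Import numFieldNormedType.Exports.

Local Open Scope classical_set_scope.
Local Open Scope ring_scope.

(** As [xi] is the gradient of [f], the Laplacian of [f] is the divergence of
    [xi]. The soliton equation at [(xi, xi)] gives [S(xi, xi) = a - b], the Lie
    derivative vanishing there because [g(xi, xi)] is constant; its trace gives
    [div xi + r + 4 a - b = 0]. The same two contractions of Einstein's equation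
    express [S(xi, xi)] and [r] through [sigma], [p] and [lambda]; eliminating
    [S(xi, xi)], [r] and [a] leaves the Poisson equation. *)

(** Supplies the test fields for tracing: basis vectors extend to constant fields, at which both
    tensor equations may be evaluated. *)
Lemma smooth_on_cst (R : realType) (V W : normedModType R) (U : set V) (c : W) :
  smooth_on U (cst c).
Proof.
move=> k; elim: k c => [|k IH] c /=; first by move=> u _; exact: cst_continuous.
split=> [u _|v]; first exact: differentiable_cst.
have -> : (fun u => 'D_v (cst c : V -> W) u) = cst 0.
  by apply/funext => u; rewrite derive_cst.
exact: IH.
Qed.

Lemma smooth_on_differentiable (R : realType) (V W : normedModType R)
    (U : set V) (h : V -> W) u : smooth_on U h -> U u -> differentiable h u.
Proof. by move=> /(_ 1%N)[+ _] => /[apply]. Qed.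

Section MetricTrace.
Variables (R : realType) (n : nat).
Notation E := 'rV[R]_n.

Lemma innerDl (B : 'M[R]_n) (v v' w : E) :
  inner B (v + v') w = inner B v w + inner B v' w.
Proof. by rewrite /inner !mulmxDl mxE. Qed.

Lemma innerDr (B : 'M[R]_n) (v w w' : E) :
  inner B v (w + w') = inner B v w + inner B v w'.
Proof. by rewrite /inner linearD /= mulmxDr mxE. Qed.

Lemma innerNl (B : 'M[R]_n) (v w : E) : inner B (- v) w = - inner B v w.
Proof. by rewrite /inner !mulNmx mxE. Qed.

Lemma innerNr (B : 'M[R]_n) (v w : E) : inner B v (- w) = - inner B v w.
Proof. by rewrite /inner linearN /= mulmxN mxE. Qed.

Lemma inner0l (B : 'M[R]_n) (w : E) : inner B 0 w = 0.
Proof. by rewrite /inner !mul0mx mxE. Qed.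

Lemma inner0r (B : 'M[R]_n) (v : E) : inner B v 0 = 0.
Proof. by rewrite /inner trmx0 mulmx0 mxE. Qed.

Lemma inner_basis (B : 'M[R]_n) i (w : E) :
  inner B (basis_vec R i) w = (B *m w^T) i 0.
Proof. by rewrite /inner /basis_vec -mulmxA -rowE mxE. Qed.

Lemma inner_basisr (B : 'M[R]_n) (v : E) j :
  inner B v (basis_vec R j) = (v *m B) 0 j.
Proof. by rewrite /inner /basis_vec trmx_delta -colE mxE. Qed.

Variable B : 'M[R]_n.

(** Contraction with the inverse metric. [T] is any function, read off on basis vectors only, so no
    bilinearity has to be proved; [scalar_curvature] is an instance by conversion. *)
Definition metric_trace (T : E -> E -> R) : R :=
  \sum_i \sum_j invmx B i j * T (basis_vec R i) (basis_vec R j).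

Lemma metric_traceE (T : E -> E -> R) :
  metric_trace T =
  \tr (invmx B *m (\matrix_(i, j) T (basis_vec R i) (basis_vec R j))^T).
Proof.
apply: eq_bigr => i _; rewrite mxE; apply: eq_bigr => j _.
by rewrite !mxE.
Qed.

Lemma metric_traceD (T T' : E -> E -> R) :
  metric_trace (fun v w => T v w + T' v w) = metric_trace T + metric_trace T'.
Proof.
rewrite /metric_trace -big_split; apply: eq_bigr => i _.
by rewrite -big_split; apply: eq_bigr => j _; rewrite mulrDr.
Qed.

Lemma metric_traceZ c (T : E -> E -> R) :
  metric_trace (fun v w => c * T v w) = c * metric_trace T.
Proof.
rewrite /metric_trace big_distrr; apply: eq_bigr => i _ /=.
by rewrite big_distrr; apply: eq_bigr => j _; rewrite mulrCA.
Qed.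

Lemma eq_metric_trace (T T' : E -> E -> R) :
  (forall i j, T (basis_vec R i) (basis_vec R j) =
               T' (basis_vec R i) (basis_vec R j)) ->
  metric_trace T = metric_trace T'.
Proof.
by move=> eqT; apply: eq_bigr => i _; apply: eq_bigr => j _; rewrite eqT.
Qed.

Hypotheses (B_sym : B^T = B) (B_unit : B \in unitmx).

Lemma metric_trace_inner : metric_trace (inner B) = n%:R.
Proof.
rewrite metric_traceE.
have -> : \matrix_(i, j) inner B (basis_vec R i) (basis_vec R j) = B.
  apply/matrixP => i j.
  by rewrite mxE inner_basis /basis_vec trmx_delta -colE mxE.
by rewrite B_sym mulVmx// mxtrace1.
Qed.

(** The Gram matrix is the column [B *m z^T] times its transpose; cyclicity turns the contraction
    into the trace of a one-by-one matrix. *)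
Lemma metric_trace_dual (z : E) :
  metric_trace (fun v w => inner B v z * inner B w z) = inner B z z.
Proof.
rewrite metric_traceE.
have -> : \matrix_(i, j) (inner B (basis_vec R i) z * inner B (basis_vec R j) z)
    = (B *m z^T) *m (B *m z^T)^T.
  apply/matrixP => i j; rewrite [LHS]mxE [RHS]mxE big_ord1 !inner_basis.
  by rewrite [X in _ = _ * X]mxE.
rewrite trmx_mul trmxK !mulmxA mulVmx// mul1mx trmx_mul trmxK B_sym.
by rewrite mxtrace_mulC /mxtrace big_ord1.
Qed.

(** [lin1_mx] records the values of [L] on basis vectors, so the Gram matrix factors as
    [lin1_mx L *m B], and the inverse metric cancels [B]. *)
Lemma metric_trace_endol (L : E -> E) :
  metric_trace (fun v w => inner B (L v) w) = trace L.
Proof.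
rewrite metric_traceE.
have -> : \matrix_(i, j) inner B (L (basis_vec R i)) (basis_vec R j) =
    lin1_mx L *m B.
  apply/matrixP => i j; rewrite mxE inner_basisr !mxE.
  by apply: eq_bigr => l _; rewrite mxE.
by rewrite trmx_mul B_sym mulmxA mulVmx// mul1mx mxtrace_tr.
Qed.

Lemma metric_trace_endor (L : E -> E) :
  metric_trace (fun v w => inner B v (L w)) = trace L.
Proof.
rewrite metric_traceE.
have -> : \matrix_(i, j) inner B (basis_vec R i) (L (basis_vec R j)) =
    B *m (lin1_mx L)^T.
  apply/matrixP => i j; rewrite mxE inner_basis !mxE.
  by apply: eq_bigr => l _; rewrite !mxE.
by rewrite trmx_mul trmxK B_sym mxtrace_mulC -mulmxA mulmxV// mulmx1.
Qed.

End MetricTrace.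

Section LieDerivative.
Variables (R : realType) (n : nat).
Notation E := 'rV[R]_n.
Variables (G : E -> 'M[R]_n) (u : E).

(** Metric compatibility expands the derivative along [Z], torsion-freeness expands the brackets,
    and the terms in [nabla G Z X] and [nabla G Z Y] cancel. *)
Lemma lie_metric_nabla (Z X Y : E -> E) :
  (\forall w \near u, (G w)^T = G w) -> G u \in unitmx ->
  differentiable G u -> differentiable X u -> differentiable Y u ->
  lie_metric G Z X Y u =
  inner (G u) (nabla G X Z u) (Y u) + inner (G u) (X u) (nabla G Y Z u).
Proof.
move=> G_sym G_unit dG dX dY.
rewrite /lie_metric nabla_metric// -!(nabla_torsion_free G_sym).
rewrite innerDl innerDr innerNl innerNr; ring.
Qed.

(** Both terms of [lie_metric_nabla] contract to the trace of the same map
    [v |-> nabla G (cst v) Z u]. *)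
Lemma metric_trace_lie (Z : E -> E) :
  (\forall w \near u, (G w)^T = G w) -> G u \in unitmx -> differentiable G u ->
  metric_trace (G u) (fun v w => lie_metric G Z (cst v) (cst w) u) =
  2 * divergence G Z u.
Proof.
move=> G_sym G_unit dG.
pose L v := nabla G (cst v) Z u.
rewrite (@eq_metric_trace _ _ _ _
    (fun v w => inner (G u) (L v) w + inner (G u) v (L w))); last first.
  by move=> i j; rewrite lie_metric_nabla//; exact: differentiable_cst.
have Gu_sym := nbhs_singleton G_sym.
rewrite metric_traceD metric_trace_endol// metric_trace_endor//.
by rewrite mulr2n mulrDl !mul1r.
Qed.

Lemma lie_metric_diag (Z : E -> E) c :
  (\forall w \near u, inner (G w) (Z w) (Z w) = c) -> lie_metric G Z Z Z u = 0.
Proof.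
move=> Zc; rewrite /lie_metric /lie_bracket subrr inner0l inner0r !subr0.
by rewrite (near_eq_derive _ (g := cst c)) ?derive_cst.
Qed.

(** Allows [xi] to replace the gradient of [f]: the two are known to agree only on the chart image,
    an open neighbourhood of the point. *)
Lemma near_eq_divergence (Y Z : E -> E) :
  {near u, Y =1 Z} -> divergence G Y u = divergence G Z u.
Proof.
move=> YZ; rewrite /divergence; congr trace; apply/funext => y.
by rewrite /nabla (near_eq_derive _ YZ) (nbhs_singleton YZ).
Qed.

End LieDerivative.

Lemma minkowski_unit (R : realType) (n : nat) : Defs.minkowski R n \in unitmx.
Proof.
rewrite unitmxE det_diag unitfE; apply/prodf_neq0 => i _.
by rewrite mxE; case: ifP; rewrite ?oppr_eq0 oner_eq0.
Qed.

(** The metric is congruent to a diagonal matrix with entries [1] and [-1], and the factors of an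
    invertible product of square matrices are invertible. *)
Lemma lorentzian_unit (R : realType) (n : nat) (M : topologicalType)
    (A : smooth_manifold R n M) (g : chart A -> 'rV[R]_n -> 'M[R]_n) i u :
  lorentzian_metric g -> chart_img i u -> g i u \in unitmx.
Proof.
move=> [_ _ + _] => /[apply] -[P P_unit PgP].
have := minkowski_unit R n.
by rewrite -PgP !unitmx_mul unitmx_tr P_unit andbT.
Qed.

Theorem theorem4p1 (R : realType) (M : topologicalType)
    (A : smooth_manifold R 4 M)
    (g : chart A -> 'rV[R]_4 -> 'M[R]_4)
    (xi : chart A -> 'rV[R]_4 -> 'rV[R]_4)
    (p sigma f : M -> R) (lambda k a b : R)
    (k_gt0 : 0 < k)
    (fluid : perfect_fluid_spacetime g xi p sigma lambda k)
    (f_smooth : smooth_function A f)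
    (xi_grad : forall (i : chart A) u, chart_img i u ->
       xi i u = grad (g i) (f \o chart_inv i) u)
    (soliton : eta_ricci_soliton g xi a b) :
  forall (i : chart A) x, chart_dom i x ->
    laplacian (g i) (f \o chart_inv i) (chart_map i x)
    = - 3 * (b + k * (sigma x + p x)).
Proof.
move=> i x ix; have [lor [xi_smooth _] _ xi_unit einstein] := fluid.
have [g_smooth g_sym _ _] := lor.
pose u := chart_map i x; have iu : chart_img i u by exists x.
have near_img : \forall w \near u, chart_img i w.
  by apply: open_nbhs_nbhs; split; [exact: chart_img_open|].
have sym_near : \forall w \near u, (g i w)^T = g i w.
  by apply: filterS near_img => w; exact: g_sym.
have gu_sym := g_sym _ _ iu; have gu_unit := lorentzian_unit lor iu.
have dg := smooth_on_differentiable (g_smooth i) iu.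
have pu : (p \o chart_inv i) u = p x by rewrite /= chart_mapK.
have su : (sigma \o chart_inv i) u = sigma x by rewrite /= chart_mapK.
have -> : laplacian (g i) (f \o chart_inv i) (chart_map i x) =
    divergence (g i) (xi i) u.
  apply: near_eq_divergence; apply: filterS near_img => w iw.
  by rewrite xi_grad.
have cst_smooth v : smooth_on (chart_img i) (cst v : 'rV[R]_4 -> 'rV[R]_4).
  exact: smooth_on_cst.
have sol_xi := soliton i _ _ (xi_smooth i) (xi_smooth i) u iu.
have ein_xi := einstein i _ _ (xi_smooth i) (xi_smooth i) u iu.
rewrite (lie_metric_diag (c := -1)) in sol_xi; last first.
  by apply: filterS near_img => w; exact: xi_unit.
rewrite /energy_momentum /dual_form xi_unit// ?pu ?su in sol_xi ein_xi.
pose S v w := ricci (g i) (cst v) (cst w) u.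
pose eta2 v w := inner (g i u) v (xi i u) * inner (g i u) w (xi i u).
have trS : metric_trace (g i u) S = scalar_curvature (g i) u by [].
have tr_inner := metric_trace_inner gu_sym gu_unit.
have tr_eta2 : metric_trace (g i u) eta2 = -1.
  by rewrite metric_trace_dual// xi_unit.
(* The right-hand side of the soliton equation must also be a trace for [eq_metric_trace] to compare
   the two sides entrywise. *)
have tr0 : metric_trace (g i u) (fun _ _ => 0) = 0.
  by rewrite /metric_trace big1// => ? _; rewrite big1// => ? _; rewrite mulr0.
have sol_tr : 2 * divergence (g i) (xi i) u + 2 * scalar_curvature (g i) u
    + 2 * a * 4%:R + 2 * b * -1 = 0.
  rewrite -metric_trace_lie// -trS -tr_inner -tr_eta2 -!metric_traceZ.
  rewrite -!metric_traceD -[RHS]tr0; apply: eq_metric_trace => v w.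
  exact: (soliton i _ _ (cst_smooth _) (cst_smooth _) u iu).
have ein_tr : k * (p x * 4%:R + (sigma x + p x) * -1) =
    scalar_curvature (g i) u + (lambda - scalar_curvature (g i) u / 2) * 4%:R.
  (* Only the first scalar curvature is the trace of [S]; the second is a coefficient of the metric
     and stays. *)
  rewrite -{1}trS -tr_inner -tr_eta2 -!metric_traceZ -!metric_traceD.
  rewrite -metric_traceZ; apply: eq_metric_trace => v w.
  rewrite -pu -su.
  exact: (einstein i _ _ (cst_smooth _) (cst_smooth _) u iu).
(* With [r] the scalar curvature and [S] the value at [(xi, xi)], the soliton pair gives
   [div xi = - r - 4 S - 3 b]. Einstein's pair gives [S = k sigma + lambda - r / 2] and
   [r = 4 lambda + k (sigma - 3 p)], so [lambda] cancels. *)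
lra.
Qed.
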